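(* Let $k\geq 4$ be an integer and let $m=3k-4$. Then there exists an arrangement of $2^{k+1}-1$ distinct lines in $\mathbb{P}^2(\mathbb{F}_{2^{m}})$ with $\frac{(2^{k+1}-1)(2^k-1)}{3}$ triple intersection points (points lying on exactly three of the lines) and no other intersection points.
   Context: An intersection point of a line arrangement is a point lying on at least two of its lines. *)

(* Defs.v *)
From HB Require Import structures.
From mathcomp Require Import all_boot all_order all_algebra.

Set Implicit Arguments.
Unset Strict Implicit.
Unset Printing Implicit Defensive.

Import VectorInternalTheory.

(* The library gives {vspace vT} only a choice structure; over a finite field
   it is finite, as a subtype of a type of matrices. *)
HB.instance Definition _ (F : finFieldType) (vT : vectType F) :=
  [Countable of {vspace vT} by <:].
HB.instance Definition _ (F : finFieldType) (vT : vectType F) :=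
  [Finite of {vspace vT} by <:].

Section ProjectivePlane.

Variable F : finFieldType.

Definition pg2_point := {U : {vspace 'rV[F]_3} | \dim U == 1%N}.
Definition pg2_line := {U : {vspace 'rV[F]_3} | \dim U == 2%N}.

Definition pg2_incident (p : pg2_point) (l : pg2_line) : bool :=
  (val p <= val l)%VS.

Definition lines_through (A : {set pg2_line}) (p : pg2_point) :
  {set pg2_line} := [set l in A | pg2_incident p l].

Definition intersection_points (A : {set pg2_line}) : {set pg2_point} :=
  [set p | 2 <= #|lines_through A p|].

Definition triple_points (A : {set pg2_line}) : {set pg2_point} :=
  [set p | #|lines_through A p| == 3].

End ProjectivePlane.

(* Main.v *)
Require Import Defs.
From HB Require Import structures.
From mathcomp Require Import all_boot all_order all_algebra.
From mathcomp Require Import all_fingroup all_solvable all_field.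
From mathcomp Require Import zify ring.

(** The lines [l_x : x X + x^2 Y + x^4 Z = 0], for [x] running over the nonzero
    elements of an additive subgroup [V] of [F] of order [2^(k+1)], form such an
    arrangement.  The [x] with [l_x] passing through a given point [(X : Y : Z)]
    are the nonzero roots in [V] of an additive polynomial of degree at most 4;
    together with 0 they form an elementary abelian 2-group of order at most 4,
    so there are 0, 1 or 3 of them.  The triple points are then counted from the
    pairs of lines. *)

Set Implicit Arguments.
Unset Strict Implicit.
Unset Printing Implicit Defensive.

Section Arrangement.

Import GRing.Theory.
Local Open Scope ring_scope.

Variable F : finFieldType.

(** Grassmann's formula in a space of dimension 3 forces dimension at least 1, and dimension 2 would
    make both planes equal to their intersection. *)
Lemma dim_cap_planes (U W : {vspace 'rV[F]_3}) :
  \dim U = 2 -> \dim W = 2 -> U != W -> \dim (U :&: W) = 1%N.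
Proof.
move=> dU dW UW.
have := dimv_sum_cap U W; rewrite dU dW => dS.
have leS : (\dim (U + W) <= 3)%N.
  by apply: leq_trans (dimvS (subvf _)) _; rewrite dimvf.
have cap_lt: (\dim (U :&: W) < 2)%N.
  rewrite ltnNge; apply: contra UW => le2.
  have /eqP <- : (U :&: W == U)%VS by rewrite eqEdim capvSl dU.
  by rewrite eqEdim capvSr dW.
lia.
Qed.

Lemma unique_meet (l1 l2 : pg2_line F) :
  l1 != l2 -> #|[set p | pg2_incident p l1 && pg2_incident p l2]| = 1%N.
Proof.
move=> l12; have d1 : \dim (val l1 :&: val l2) == 1%N.
  apply/eqP; apply: dim_cap_planes => /=; last exact: l12.
    exact: eqP (valP l1).
  exact: eqP (valP l2).
pose q : pg2_point F := exist _ (val l1 :&: val l2)%VS d1.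
apply/eqP/cards1P; exists q; apply/setP=> p; rewrite !inE /pg2_incident.
rewrite -subv_cap -val_eqE /= eqEdim.
by move: (eqP d1) (eqP (valP p)) => /= -> ->; rewrite andbT.
Qed.

(** Both sides count the triples [(l1, l2, p)] with [l1], [l2] distinct lines of [A] through [p]:
    each ordered pair meets in one point, and each triple point carries 3 * 2 ordered pairs. *)
Lemma double_count_triples (A : {set pg2_line F}) :
    (forall p, p \in intersection_points A -> p \in triple_points A) ->
  (#|A| * (#|A| - 1) = #|triple_points A| * 6)%N.
Proof.
move=> triA.
have -> : (#|A| * (#|A| - 1) = \sum_(l1 in A) \sum_(l2 in A | l2 != l1)
    \sum_(p | pg2_incident p l1 && pg2_incident p l2) 1)%N.
  rewrite -sum_nat_const; apply: eq_bigr => l1 l1A.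
  rewrite (cardsD1 l1) l1A addKn -sum1_card; apply: eq_big => [l2|l2].
    by rewrite !inE andbC.
  rewrite !inE => /andP[l21 _]; rewrite sum1dep_card unique_meet //.
  by rewrite eq_sym.
under eq_bigr => l1 _ do rewrite (exchange_big_dep predT) //=.
rewrite (exchange_big_dep predT) //=.
rewrite -sum_nat_const [RHS]big_mkcond /=; apply: eq_bigr => p _.
transitivity (#|lines_through A p| * (#|lines_through A p| - 1))%N.
  rewrite -sum_nat_const (bigID (fun l => pg2_incident p l)) /=.
  rewrite [X in (_ + X)%N]big1 ?addn0 => [|l1 /andP[_ /negPf np]]; last first.
    by rewrite big_pred0 // => l2; rewrite np andbF.
  apply: eq_big => [l1|l1 /andP[/andP[l1A _] pl1]]; first by rewrite !inE andbT.
  rewrite (cardsD1 l1) [l1 \in _]inE l1A pl1 addKn sum1dep_card; apply: eq_card.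
  by move=> l2; rewrite !inE /= andbA (andbC (l2 \in A)).
(* A point that is not triple lies on at most one line of [A], so it contributes n * (n - 1) = 0. *)
have [/[!inE]/eqP-> //|] := boolP (p \in triple_points A).
move=> /(contra (triA p)); rewrite inE -ltnNge.
by case: #|_| => [|[|]].
Qed.

Hypothesis char2 : 2%N \in [pchar F].

(** The exponents 1, 2, 4 are powers of the characteristic, so each entry is additive in [x]. *)
Definition coef (x : F) : 'cV[F]_3 := \col_i x ^+ (2 ^ i).

(** [1 + 1 : 'I_3] is the last index. *)
Lemma mul_coef (v : 'rV[F]_3) x : (v *m coef x) 0 0 =
  v 0 0 * x + v 0 1 * x ^+ 2 + v 0 (1 + 1) * x ^+ 4.
Proof.
rewrite mxE !big_ord_recr big_ord0 /= !mxE /= add0r.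
by congr (_ * _ + _ * _ + _ * _); congr (v _ _); apply: val_inj.
Qed.

Definition line_space (x : F) : {vspace 'rV[F]_3} :=
  lker (linfun (mulmxr (coef x))).

Lemma mem_line_space v x : (v \in line_space x) =
  (v 0 0 * x + v 0 1 * x ^+ 2 + v 0 (1 + 1) * x ^+ 4 == 0).
Proof.
rewrite memv_ker lfunE /= -mul_coef; apply/eqP/eqP => [->|v0]; first by rewrite mxE.
by apply/matrixP => i j; rewrite !ord1 v0 mxE.
Qed.

Lemma dim_line_space x : x != 0 -> \dim (line_space x) == 2%N.
Proof.
move=> x0; pose f : 'Hom('rV[F]_3, 'rV[F]_1) := linfun (mulmxr (coef x)).
have := limg_ker_dim f fullv; rewrite capfv dimvf /dim /= mul1n.
(* The form is nonzero, since it sends the first basis vector to [x]. *)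
have -> : (\dim (f @: fullv) = 1)%N.
  apply/eqP; rewrite eqn_leq (leq_trans (dimvS (subvf _))) ?dimvf //=.
  rewrite lt0n dimv_eq0 -subv0; apply/negP => /subvP/(_ (f (delta_mx 0 0))).
  rewrite memv_img ?memvf // => /(_ isT); rewrite memv0 lfunE /= => /eqP.
  move=> /matrixP/(_ 0 0); rewrite mul_coef !mxE /= => /eqP.
  by rewrite mul1r !mul0r !addr0 (negPf x0).
by rewrite addn1 => -[->].
Qed.

Lemma line_space_inj x y : x != 0 -> y != 0 -> line_space x = line_space y -> x = y.
Proof.
(* At [v] = (x, 1, 0) the form of parameter [z] takes the value z (x + z), whose only nonzero root
   in characteristic 2 is [x]. *)
move=> x0 y0 exy; pose v : 'rV[F]_3 := \row_i nth 0 [:: x; 1] i.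
have vE z : v \in line_space z = (z * (x + z) == 0).
  by rewrite mem_line_space !mxE /= mul0r addr0; congr (_ == _); ring.
have: v \in line_space y by rewrite -exy vE addrr_pchar2 ?mulr0.
rewrite vE mulf_eq0 (negPf y0) /= addr_eq0 => /eqP ->.
by rewrite oppr_pchar2.
Qed.

Definition root_set (v : 'rV[F]_3) : {set F} := [set x | v \in line_space x].

Lemma root_setD v x y :
  x \in root_set v -> y \in root_set v -> x + y \in root_set v.
Proof.
rewrite !inE !mem_line_space => /eqP ex /eqP ey.
have sqrD (a b : F) : (a + b) ^+ 2 = a ^+ 2 + b ^+ 2.
  exact: (pFrobenius_autD_comm char2 (mulrC a b)).
rewrite -[4%N]/(2 * 2)%N !exprM !sqrD -!exprM.
by apply/eqP; have := congr2 +%R ex ey; rewrite addr0 => <-; ring.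
Qed.

(** Dividing the additive polynomial by its factor x leaves the polynomial [P], nonzero of degree at
    most 3; the exponents 1, 2, 4 become 0, 1, 3. *)
Lemma card_root_set v : v != 0 -> (#|root_set v :\ 0%R| <= 3)%N.
Proof.
move=> v0; pose P : {poly F} := Poly [:: v 0 0; v 0 1; 0; v 0 (1 + 1)].
have PE x : P.[x] = v 0 0 + v 0 1 * x + v 0 (1 + 1) * x ^+ 3.
  by rewrite horner_Poly /=; ring.
have P0 : P != 0.
  apply: contraNneq v0 => eP; apply/eqP/rowP => i; rewrite mxE.
  have cP j : P`_j = 0 by rewrite eP coef0.
  move: (cP 0%N) (cP 1%N) (cP 3%N); rewrite !coef_Poly /= => c0 c1 c3.
  case: i => [[|[|[|//]]] lti]; [rewrite -c0|rewrite -c1|rewrite -c3];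
    by congr (v _ _); apply: val_inj.
have szP : (size P <= 4)%N by apply: size_Poly.
rewrite cardE -ltnS (leq_trans _ szP) // max_poly_roots ?enum_uniq //.
apply/allP => x; rewrite mem_enum !inE mem_line_space => /andP[x0 /eqP ex].
apply/eqP/(mulfI x0); rewrite mulr0 -{}ex PE; ring.
Qed.

Variable V : {set F}.
Hypothesis VD : {in V &, forall x y, x + y \in V}.

(** Junk value: [line_of 0 = line_of 1]. *)
Definition line_of (x : F) : pg2_line F :=
  if insub (line_space x) is Some l then l
  else exist _ (line_space 1) (dim_line_space (oner_neq0 F)).

Lemma val_line_of x : x != 0 -> val (line_of x) = line_space x.
Proof. by move=> x0; rewrite /line_of insubT ?dim_line_space. Qed.

Definition arrangement : {set pg2_line F} := line_of @: (V :\ 0).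

Lemma line_of_inj : {in [pred x | x != 0] &, injective line_of}.
Proof.
move=> x y x0 y0 /(congr1 val); rewrite !val_line_of //.
exact: line_space_inj.
Qed.

Lemma card_arrangement : #|arrangement| = #|V :\ 0|.
Proof.
apply: card_in_imset => x y; rewrite !inE => /andP[x0 _] /andP[y0 _].
exact: line_of_inj.
Qed.

(** The vector [v] gives homogeneous coordinates of [p], which turns incidence with [line_of x] into
    a polynomial equation in [x]. *)
Lemma lines_through_arrangement p :
  exists2 v, v != 0 &
    lines_through arrangement p = line_of @: (V :&: root_set v :\ 0).
Proof.
have dp := eqP (valP p); pose v := vpick (val p).
have p0 : val p != 0%VS by rewrite -dimv_eq0 dp.
have v0 : v != 0 by rewrite vpick0.
have ep : val p = <[v]>%VS.
  by apply/esym/eqP; rewrite eqEdim -memvE memv_pick dim_vline v0 dp.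
exists v => //; apply/setP => l; rewrite inE /pg2_incident ep -memvE.
apply/andP/imsetP => [[/imsetP[x]]|[x]]; rewrite !inE.
  by move=> /andP[x0 xV] -> vl; exists x; rewrite // !inE x0 xV -val_line_of.
move=> /and3P[x0 xV vx] ->; rewrite val_line_of //; split=> //.
by apply/imsetP; exists x; rewrite ?inE ?x0.
Qed.

(** Two lines through [p], of parameters [x] and [y], force a third one of parameter [x + y]; the
    bound on the roots excludes a fourth. *)
Lemma arrangement_triple p :
  p \in intersection_points arrangement -> p \in triple_points arrangement.
Proof.
rewrite !inE; have [v v0 ->] := lines_through_arrangement p.
rewrite card_in_imset => [|x y]; last first.
  by rewrite !inE => /andP[x0 _] /andP[y0 _]; exact: line_of_inj.
set S := V :&: _ :\ 0 => S2; rewrite eqn_leq; apply/andP; split.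
  by apply: leq_trans (card_root_set v0); apply/subset_leq_card/setSD/subsetIr.
have /card_gt1P[x [y [xS yS xy]]] := S2.
have xyS : x + y \in S.
  move: xS yS; rewrite 3!in_setD1 !in_setI => /and3P[x0 xV xr] /and3P[y0 yV yr].
  by rewrite VD // root_setD // addr_eq0 oppr_pchar2 ?xy.
have [x0 y0] : x != 0 /\ y != 0.
  by move: xS yS; rewrite !in_setD1 => /andP[-> _] /andP[-> _].
apply/card_gt2P; exists x, y, (x + y); split=> //; split=> //.
  by rewrite eq_sym -subr_eq0 addrK.
by rewrite -subr_eq0 addrAC subrr add0r.
Qed.

End Arrangement.

(** The group law on [F] is addition, with neutral element 0; a finite 2-group has subgroups of
    every order dividing its own. *)
Lemma subgroup_of_order (F : finFieldType) (m j : nat) :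
  #|F| = 2 ^ m -> j <= m -> exists V : {group F}, #|V| = 2 ^ j.
Proof.
move=> hF jm; have cG : #|[set: F]| = 2 ^ m by rewrite cardsT.
have pG : (2.-group [set: F])%g by rewrite /pgroup cG pnatX pnat_id.
have [|V [_ _ cV]] := normal_pgroup pG (normal_refl _) (r := j).
  by rewrite cG pfactorK.
by exists V.
Qed.

Theorem mainTheorem5 (k m : nat) (hk : 4 <= k) (hm : m = 3 * k - 4)
    (F : finFieldType) (hF : #|F| = 2 ^ m) :
  exists A : {set pg2_line F},
    [/\ #|A| = 2 ^ k.+1 - 1,
        #|triple_points A| = (2 ^ k.+1 - 1) * (2 ^ k - 1) %/ 3
      & forall p, p \in intersection_points A -> p \in triple_points A].
Proof.
(* The field must be large enough to contain an additive subgroup of order 2^(k+1). *)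
have km : k.+1 <= m by lia.
have char2 : 2 \in [pchar F]%R by apply: card_finPcharP hF _.
have [V cV] := subgroup_of_order hF km.
have VD : {in V &, forall x y, (x + y)%R \in V} by move=> x y; apply: groupM.
have triA p := arrangement_triple char2 VD (p := p).
have cA : #|arrangement V| = 2 ^ k.+1 - 1.
  have V0 : 0%R \in V := group1 V.
  by rewrite (card_arrangement char2) -cV (cardsD1 0%R V) V0 addKn.
exists (arrangement V); split=> //.
have := double_count_triples triA; rewrite cA => eT.
(* Since 2^(k+1) - 2 = 2 (2^k - 1), halving the double count yields this equality, which also shows
   that the division by 3 is exact. *)
have -> : (2 ^ k.+1 - 1) * (2 ^ k - 1) = #|triple_points (arrangement V)| * 3.
  by move: eT; rewrite expnS; nia.
by rewrite mulnK.
Qed.
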